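(* Suppose $\mathcal{C}_n$ has two path-connected components $\mathcal{C}_n^{(1)}$ and $\mathcal{C}_n^{(2)}$. Then, for any invertible matrix $T\in\mathbb{R}^{n\times n}$ with $\det T<0$, $\mathcal{C}_n^{(1)}$ and $\mathcal{C}_n^{(2)}$ are diffeomorphic under the mapping $\mathscr{T}_T$; that is, $\mathscr{T}_T$ restricts to a diffeomorphism from $\mathcal{C}_n^{(1)}$ onto $\mathcal{C}_n^{(2)}$.
   Context: Fix integers $n,m,p\ge 1$, real matrices $A\in\mathbb{R}^{n\times n}$, $B\in\mathbb{R}^{n\times m}$, $C\in\mathbb{R}^{p\times n}$ (the plant $\dot x=Ax+Bu+w$, $y=Cx+v$), and real symmetric matrices $W\succeq 0$ ($n\times n$), $V\succ 0$ ($p\times p$), $Q\succeq 0$ ($n\times n$), $R\succ 0$ ($m\times m$). Standing assumption: $(A,B)$ and $(A,W^{1/2})$ are controllable, and $(C,A)$ and $(Q^{1/2},A)$ are observable. A real square matrix is called stable if all its eigenvalues have negative real part. The set of full-order strictly proper stabilizing controllers is $$\mathcal{C}_n=\left\{\mathsf{K}=\begin{bmatrix}0_{m\times p}&C_{\mathsf K}\\ B_{\mathsf K}&A_{\mathsf K}\end{bmatrix}\in\mathbb{R}^{(m+n)\times(p+n)}\ \middle|\ A_{\mathsf K}\in\mathbb{R}^{n\times n},\,B_{\mathsf K}\in\mathbb{R}^{n\times p},\,C_{\mathsf K}\in\mathbb{R}^{m\times n},\ \begin{bmatrix}A&BC_{\mathsf K}\\ B_{\mathsf K}C&A_{\mathsf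 K}\end{bmatrix}\text{ is stable}\right\}.$$ It is an open subset of the linear space $\mathcal{V}_n$ of matrices in $\mathbb{R}^{(m+n)\times(p+n)}$ whose upper-left $m\times p$ block is zero. For invertible $T\in\mathbb{R}^{n\times n}$, the similarity transformation $\mathscr{T}_T:\mathcal{C}_n\to\mathcal{C}_n$ is $$\mathscr{T}_T(\mathsf K)=\begin{bmatrix}0&C_{\mathsf K}T^{-1}\\ TB_{\mathsf K}&TA_{\mathsf K}T^{-1}\end{bmatrix}.$$ *)

(* Defs.v *)
From HB Require Import structures.
From mathcomp Require Import all_boot all_order all_algebra.
From mathcomp Require Import all_classical all_reals all_analysis.
From mathcomp Require Import complex.

Set Implicit Arguments.
Unset Strict Implicit.
Unset Printing Implicit Defensive.

Import Order.TTheory GRing.Theory Num.Theory.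
Import numFieldNormedType.Exports.

Local Open Scope classical_set_scope.
Local Open Scope ring_scope.

(* Positive (semi)definiteness includes symmetry. *)
Definition psdmx (R : realType) (n : nat) (S : 'M[R]_n) : Prop :=
  S^T = S /\ forall x : 'cV[R]_n, 0 <= (x^T *m S *m x) 0 0.

Definition pdmx (R : realType) (n : nat) (S : 'M[R]_n) : Prop :=
  S^T = S /\ forall x : 'cV[R]_n, x != 0 -> 0 < (x^T *m S *m x) 0 0.

(* Principal square root; the set below is a singleton when S is positive
   semidefinite, the default 0 being used only for other matrices. *)
Definition sqrtmx (R : realType) (n : nat) (S : 'M[R]_n) : 'M[R]_n :=
  xget 0 [set X : 'M[R]_n | psdmx X /\ X *m X = S].

(* Kalman: [B, AB, ..., A^(n-1) B] has full row rank. *)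
Definition controllable (R : realType) (n m : nat)
    (A : 'M[R]_n) (B : 'M[R]_(n, m)) : Prop :=
  \rank (\mxrow_(k < n) (A ^+ k *m B)) = n.

Definition observable (R : realType) (n p : nat)
    (C : 'M[R]_(p, n)) (A : 'M[R]_n) : Prop :=
  \rank (\mxcol_(k < n) (C *m A ^+ k)) = n.

(* The eigenvalues are the complex ones. *)
Definition stablemx (R : realType) (n : nat) (M : 'M[R]_n) : Prop :=
  forall z : R[i],
    eigenvalue (map_mx (real_complex R) M) z -> complex.Re z < 0.

Definition controller_space (R : realType) (n m p : nat) :
    set 'M[R]_(m + n, p + n) :=
  [set K | ulsubmx K = 0].

(* C_K, B_K, A_K are the blocks ursubmx K, dlsubmx K, drsubmx K. *)
Definition stabilizing_controllers (R : realType) (n m p : nat)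
    (A : 'M[R]_n) (B : 'M[R]_(n, m)) (C : 'M[R]_(p, n)) :
    set 'M[R]_(m + n, p + n) :=
  [set K | ulsubmx K = 0 /\
     stablemx (block_mx A (B *m ursubmx K) (dlsubmx K *m C) (drsubmx K))].

Definition similarity (R : realType) (n m p : nat) (T : 'M[R]_n)
    (K : 'M[R]_(m + n, p + n)) : 'M[R]_(m + n, p + n) :=
  block_mx 0                    (ursubmx K *m invmx T)
           (T *m dlsubmx K)     (T *m drsubmx K *m invmx T).

Definition path_joined (R : realType) (X : topologicalType) (S : set X)
    (x y : X) : Prop :=
  exists gamma : R -> X,
    [/\ {within `[0, 1]%classic, continuous gamma},
        gamma 0 = x,
        gamma 1 = y
      & forall t : R, 0 <= t <= 1 -> S (gamma t)].

Definition path_components (R : realType) (X : topologicalType) (S : set X) :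
    set (set X) :=
  [set P | exists2 x, S x & P = [set y | path_joined R S x y]].

(* C^k and C^oo on a set U which is relatively open in the linear subspace L
   of E: only directions in L are used, so only the values of f on U matter.
   For finite-dimensional L this says that all iterated directional (partial)
   derivatives exist and are continuous on U. *)
Fixpoint Ck_on (R : realType) (E F : normedModType R) (k : nat)
    (L U : set E) (f : E -> F) : Prop :=
  {within U, continuous f} /\
  if k is k'.+1 then
    forall v, L v ->
      (forall x, U x -> derivable f x v) /\ Ck_on k' L U (fun x => 'D_v f x)
  else True.

Definition smooth_on (R : realType) (E F : normedModType R)
    (L U : set E) (f : E -> F) : Prop :=
  forall k : nat, Ck_on k L U f.

(* U1 and U2 are relatively open in the linear subspace L. *)
Definition diffeomorphism_on (R : realType) (E : normedModType R)
    (L U1 U2 : set E) (f : E -> E) : Prop :=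
  [/\ set_bij U1 U2 f,
      smooth_on L U1 f
    & exists g : E -> E,
        (forall x, U1 x -> g (f x) = x) /\ smooth_on L U2 g].

(* Main.v *)
Require Import Defs.
From HB Require Import structures.
From mathcomp Require Import all_boot all_order all_algebra.
From mathcomp Require Import all_classical all_reals all_analysis.
From mathcomp Require Import complex spectral mxred ring lra zify.
Import Order.TTheory GRing.Theory Num.Theory.
Import numFieldNormedType.Exports.
Local Open Scope classical_set_scope.
Local Open Scope ring_scope.

(* A similarity transformation with positive determinant moves a controller
   inside its path component, because {det > 0} is path-connected.  By
   Lyapunov's theorem a controller is stabilizing iff a matrix inequality
   M P + P M^T < 0, P > 0, is solvable; after a similarity transformation that
   normalizes the (2, 1) block of P to the identity, Scherer's change of
   variables turns it into an affine, hence convex, matrix inequality from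
   which the controller is recovered continuously.  So any controller can be
   joined by a path to a similarity transform of any other one.  If a
   similarity of negative determinant preserved a component, all of them would,
   and there would be a single component; hence it swaps the two components.
   It is linear with linear inverse, so it is a diffeomorphism. *)

Set Implicit Arguments.
Unset Strict Implicit.
Unset Printing Implicit Defensive.

(** * Entrywise limits of matrix expressions *)

Section MatrixLimits.
Context {K : numFieldType} {T : Type} {F : set_system T} {FF : Filter F}.

Lemma cvg_mx m n (f : T -> 'M[K]_(m, n)) (l : 'M[K]_(m, n)) :
  (forall i j, f x i j @[x --> F] --> l i j) -> f @ F --> l.
Proof.
move=> fl A [P Pl PA].
suff : \forall x \near F, forall ij : 'I_m * 'I_n, P ij.1 ij.2 (f x ij.1 ij.2).
  by apply: filterS => x Px; apply: PA => i j; exact: (Px (i, j)).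
by apply: filter_forall => -[i j]; apply: fl; exact: Pl.
Qed.

Lemma cvg_coord m n (f : T -> 'M[K]_(m, n)) (l : 'M[K]_(m, n)) i j :
  f @ F --> l -> f x i j @[x --> F] --> l i j.
Proof. by move=> fl; exact: cvg_comp fl (@coord_continuous _ _ _ _ _ _). Qed.

Lemma cvg_mulmx m n p (f : T -> 'M[K]_(m, n)) (g : T -> 'M[K]_(n, p))
    (a : 'M[K]_(m, n)) (b : 'M[K]_(n, p)) :
  f @ F --> a -> g @ F --> b -> f x *m g x @[x --> F] --> a *m b.
Proof.
move=> fa gb; apply: cvg_mx => i j; rewrite mxE.
under eq_fun do rewrite mxE.
by apply: cvg_big => [|k _]; [exact: add_continuous|
  by apply: cvgM; exact: cvg_coord].
Qed.

Lemma cvg_det n (f : T -> 'M[K]_n) (a : 'M[K]_n) :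
  f @ F --> a -> \det (f x) @[x --> F] --> \det a.
Proof.
move=> fa; rewrite /determinant.
apply: cvg_big => [|s _]; first exact: add_continuous.
apply: cvgM; first exact: cvg_cst.
by apply: cvg_big => [|i _]; [exact: mul_continuous|exact: cvg_coord].
Qed.

(** [invmx] is given by the adjugate formula only on [unitmx]. A nonzero determinant persists near
    the limit, so the formula holds eventually, and the adjugate is polynomial in the entries. *)
Lemma cvg_invmx n (f : T -> 'M[K]_n) (a : 'M[K]_n) : a \in unitmx ->
  f @ F --> a -> invmx (f x) @[x --> F] --> invmx a.
Proof.
move=> ua fa; have da0 : \det a != 0 by rewrite -unitfE -unitmxE.
have fu : \forall x \near F, (\det (f x))^-1 *: \adj (f x) = invmx (f x).
  apply: (filterS _ (cvgr_neq0 _ (cvg_det fa) da0)) => x.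
  by rewrite /invmx unitmxE unitfE => ->.
apply: cvg_trans (near_eq_cvg fu) _; rewrite /invmx ua.
apply: cvgZ; first exact: cvgV da0 (cvg_det fa).
apply: cvg_mx => i j; rewrite mxE; under eq_fun do rewrite mxE.
apply: cvgM; first exact: cvg_cst.
apply: cvg_det; apply: cvg_mx => k l; rewrite !mxE.
by under eq_fun do rewrite !mxE; exact: cvg_coord.
Qed.

Lemma cvg_block_mx m1 m2 n1 n2 (ul : T -> 'M[K]_(m1, n1)) (ur : T -> 'M[K]_(m1, n2))
    (dl : T -> 'M[K]_(m2, n1)) (dr : T -> 'M[K]_(m2, n2))
    (a : 'M[K]_(m1, n1)) (b : 'M[K]_(m1, n2)) (c : 'M[K]_(m2, n1)) (d : 'M[K]_(m2, n2)) :
  ul @ F --> a -> ur @ F --> b -> dl @ F --> c -> dr @ F --> d ->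
  block_mx (ul x) (ur x) (dl x) (dr x) @[x --> F] --> block_mx a b c d.
Proof.
move=> ula urb dlc drd; apply: cvg_mx => i j.
under eq_fun do rewrite !mxE; rewrite !mxE.
case: splitP => i' _; under eq_fun do rewrite mxE; rewrite mxE;
  by case: splitP => j' _; exact: cvg_coord.
Qed.

Lemma cvg_ursubmx m1 m2 n1 n2 (f : T -> 'M[K]_(m1 + m2, n1 + n2))
    (a : 'M[K]_(m1 + m2, n1 + n2)) :
  f @ F --> a -> ursubmx (f x) @[x --> F] --> ursubmx a.
Proof.
move=> fa; apply: cvg_mx => i j; rewrite !mxE; under eq_fun do rewrite !mxE.
exact: cvg_coord.
Qed.

Lemma cvg_dlsubmx m1 m2 n1 n2 (f : T -> 'M[K]_(m1 + m2, n1 + n2))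
    (a : 'M[K]_(m1 + m2, n1 + n2)) :
  f @ F --> a -> dlsubmx (f x) @[x --> F] --> dlsubmx a.
Proof.
move=> fa; apply: cvg_mx => i j; rewrite !mxE; under eq_fun do rewrite !mxE.
exact: cvg_coord.
Qed.

Lemma cvg_drsubmx m1 m2 n1 n2 (f : T -> 'M[K]_(m1 + m2, n1 + n2))
    (a : 'M[K]_(m1 + m2, n1 + n2)) :
  f @ F --> a -> drsubmx (f x) @[x --> F] --> drsubmx a.
Proof.
move=> fa; apply: cvg_mx => i j; rewrite !mxE; under eq_fun do rewrite !mxE.
exact: cvg_coord.
Qed.

End MatrixLimits.

(** * Calculus of paths inside a subset of a normed space *)

Section Paths.
Context {R : realType}.
Implicit Types E F : normedModType R.

Definition clamp01 (t : R) : R := Num.max 0 (Num.min 1 t).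

Lemma clamp01_itv t : 0 <= clamp01 t <= 1.
Proof. by rewrite /clamp01 le_max lexx ge_max ge_min lexx ler01. Qed.

Lemma clamp01_id t : 0 <= t <= 1 -> clamp01 t = t.
Proof. by case/andP => t0 t1; rewrite /clamp01 min_r// max_r. Qed.

Lemma clamp01_continuous : continuous clamp01.
Proof.
move=> t; apply: continuous_max; first exact: cvg_cst.
by apply: continuous_min; [exact: cvg_cst|exact: cvg_id].
Qed.

(* Paths may be taken globally continuous: precompose with [clamp01]. *)
Lemma path_joinedP E (S : set E) x y : path_joined R S x y <->
  exists gamma : R -> E, [/\ continuous gamma, gamma 0 = x, gamma 1 = y
    & forall t, S (gamma t)].
Proof.
split=> [[g [gc g0 g1 gS]]|[g [gc g0 g1 gS]]]; last first.
  by exists g; split=> //; exact: continuous_subspaceT.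
exists (g \o clamp01); split => /=.
- move=> t; have tI : `[0, 1]%classic (clamp01 t).
    by rewrite /= in_itv/= clamp01_itv.
  move/subspace_continuousP : gc => /(_ _ tI) gt A gA.
  have : \forall s \near t, `[0, 1]%classic (clamp01 s) -> A (g (clamp01 s)).
    exact: clamp01_continuous (gt _ gA).
  rewrite /fmap /=; apply: filterS => s; apply.
  by rewrite /= in_itv/= clamp01_itv.
- by rewrite clamp01_id// lexx ler01.
- by rewrite clamp01_id// lexx ler01.
- by move=> t; apply: gS; exact: clamp01_itv.
Qed.

Lemma path_joined_refl E (S : set E) x : S x -> path_joined R S x x.
Proof.
by move=> Sx; apply/path_joinedP; exists (cst x); split=> // t; exact: cvg_cst.
Qed.

Lemma path_joined_sym E (S : set E) x y :
  path_joined R S x y -> path_joined R S y x.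
Proof.
move=> /path_joinedP[g [gc g0 g1 gS]]; apply/path_joinedP.
exists (fun t => g (1 - t)); split=> // [t||]; rewrite ?subr0 ?subrr//.
apply: continuous_comp; last exact: gc.
by apply: cvgB; [exact: cvg_cst|exact: cvg_id].
Qed.

(* The sum of the two clamped halves, minus the value at the junction, follows
   the first path on [0, 1/2] and the second one on [1/2, 1]. *)
Lemma path_joined_trans E (S : set E) x y z :
  path_joined R S x y -> path_joined R S y z -> path_joined R S x z.
Proof.
move=> /path_joinedP[g [gc g0 g1 gS]] /path_joinedP[h [hc h0 h1 hS]].
apply/path_joinedP.
pose k t := g (clamp01 (2 * t)) + h (clamp01 (2 * t - 1)) - y.
have kl t : t <= 2^-1 -> k t = g (clamp01 (2 * t)).
  move=> t2; rewrite /k [X in h X](_ : _ = 0) ?h0 ?addrK//.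
  rewrite /clamp01 max_l// ge_min; apply/orP; right.
  by rewrite subr_le0 -ler_pdivlMl// mulr1.
have kr t : 2^-1 <= t -> k t = h (clamp01 (2 * t - 1)).
  move=> t2; rewrite /k [X in g X](_ : _ = 1) ?g1; first by rewrite addrAC subrr add0r.
  by rewrite /clamp01 min_l ?max_r// -ler_pdivrMl// mulr1.
exists k; split.
- have gc' : continuous (g \o (clamp01 \o (fun t => 2 * t))).
    move=> t; apply: continuous_comp; last exact: gc.
    apply: continuous_comp; last exact: clamp01_continuous.
    by apply: cvgM; [exact: cvg_cst|exact: cvg_id].
  have hc' : continuous (h \o (clamp01 \o (fun t => 2 * t - 1))).
    move=> t; apply: continuous_comp; last exact: hc.
    apply: continuous_comp; last exact: clamp01_continuous.
    apply: cvgB; last exact: cvg_cst.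
    by apply: cvgM; [exact: cvg_cst|exact: cvg_id].
  move=> t; apply: cvgB; last exact: cvg_cst.
  by apply: cvgD; [exact: gc'|exact: hc'].
- by rewrite kl ?invr_ge0// mulr0 clamp01_id ?lexx ?ler01.
- rewrite kr ?invf_le1 ?ler1n// mulr1 (_ : 2 - 1 = 1) ?clamp01_id ?lexx ?ler01//.
  by rewrite -[X in X - 1]/(1 + 1) addrK.
- by move=> t; case: (leP t 2^-1) => [/kl ->//|/ltW/kr ->].
Qed.

Lemma path_joined_mem E (S : set E) x y : path_joined R S x y -> S x /\ S y.
Proof. by move=> /path_joinedP[g [_ <- <- gS]]; split; exact: gS. Qed.

Lemma path_joined_map E F (S : set E) (S' : set F) (f : E -> F) x y :
  {within S, continuous f} -> (forall z, S z -> S' (f z)) ->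
  path_joined R S x y -> path_joined R S' (f x) (f y).
Proof.
move=> /subspace_continuousP fc fS /path_joinedP[g [gc g0 g1 gS]].
apply/path_joinedP; exists (f \o g); split => /=; rewrite ?g0 ?g1//.
- move=> t A fA; have : \forall s \near t, S (g s) -> A (f (g s)).
    exact: gc (fc _ (gS t) _ fA).
  by rewrite /fmap /=; apply: filterS => s; apply.
- by move=> t; apply: fS.
Qed.

Lemma path_joined_segment E (S : set E) x y :
  (forall t : R, 0 <= t <= 1 -> S (x + t *: (y - x))) -> path_joined R S x y.
Proof.
move=> xyS; exists (fun t => x + t *: (y - x)); split => //.
- apply: continuous_subspaceT => t; apply: cvgD; first exact: cvg_cst.
  by apply: cvgZ; [exact: cvg_id|exact: cvg_cst].
- by rewrite scale0r addr0.
- by rewrite scale1r addrC subrK.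
Qed.

End Paths.

(** * Path-connectedness of the matrices of positive determinant *)

Section GLplus.
Context {R : realType}.

Definition GLplus n : set 'M[R]_n := [set S | 0 < \det S].

Lemma GLplus_mull n (U S S' : 'M[R]_n) : 0 < \det U ->
  path_joined R (GLplus (n := n)) S S' ->
  path_joined R (GLplus (n := n)) (U *m S) (U *m S').
Proof.
move=> U0; apply: (@path_joined_map _ _ _ _ _ (fun V => U *m V)) => [|z z0].
  by apply: continuous_subspaceT => z; apply: (@cvg_mulmx _ _ (nbhs z));
    [exact: cvg_cst|exact: cvg_id].
by rewrite /GLplus /= det_mulmx mulr_gt0.
Qed.

Lemma GLplus_mul1 n (S S' : 'M[R]_n) :
  path_joined R (GLplus (n := n)) S 1%:M -> path_joined R (GLplus (n := n)) S' 1%:M ->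
  path_joined R (GLplus (n := n)) (S *m S') 1%:M.
Proof.
move=> S1 S'1; apply: (path_joined_trans _ S1); rewrite -{2}[S]mulmx1.
by apply: GLplus_mull S'1; case: (path_joined_mem S1).
Qed.

(** The off-diagonal block is shrunk linearly to 0; the determinant stays 1. *)
Lemma GLplus_lshear m n (w : 'M[R]_(n, m)) :
  path_joined R (GLplus (n := m + n)) (block_mx 1%:M 0 w 1%:M) 1%:M.
Proof.
rewrite (scalar_mx_block m n).
apply: (@path_joined_map _ _ _ [set: 'M[R]_(n, m)] _ (fun v => block_mx 1%:M 0 v 1%:M)).
- apply: continuous_subspaceT => v; apply: (@cvg_block_mx _ _ (nbhs v));
    by [exact: cvg_cst|exact: cvg_id].
- by move=> v _; rewrite /GLplus /= det_lblock !det1 mulr1.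
- exact: path_joined_segment.
Qed.

Lemma GLplus_ushear m n (u : 'M[R]_(m, n)) :
  path_joined R (GLplus (n := m + n)) (block_mx 1%:M u 0 1%:M) 1%:M.
Proof.
rewrite (scalar_mx_block m n).
apply: (@path_joined_map _ _ _ [set: 'M[R]_(m, n)] _ (fun v => block_mx 1%:M v 0 1%:M)).
- apply: continuous_subspaceT => v; apply: (@cvg_block_mx _ _ (nbhs v));
    by [exact: cvg_cst|exact: cvg_id].
- by move=> v _; rewrite /GLplus /= det_ublock !det1 mulr1.
- exact: path_joined_segment.
Qed.

Lemma GLplus_diag m n (a : 'M[R]_m) (d : 'M[R]_n) :
  path_joined R (GLplus (n := m)) a 1%:M -> path_joined R (GLplus (n := n)) d 1%:M ->
  path_joined R (GLplus (n := m + n)) (block_mx a 0 0 d) 1%:M.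
Proof.
move=> a1 d1.
have -> : block_mx a 0 0 d = block_mx a 0 0 1%:M *m block_mx 1%:M 0 0 d.
  by rewrite mulmx_block !(mulmx0, mul0mx, mulmx1, mul1mx, addr0, add0r).
apply: GLplus_mul1; rewrite (scalar_mx_block m n).
- apply: (@path_joined_map _ _ _ _ _ (fun v => block_mx v 0 0 1%:M)) a1 => [|v].
    by apply: continuous_subspaceT => v; apply: (@cvg_block_mx _ _ (nbhs v));
      [exact: cvg_id|exact: cvg_cst..].
  by rewrite /GLplus /= det_ublock !det1 mulr1.
- apply: (@path_joined_map _ _ _ _ _ (fun v => block_mx 1%:M 0 0 v)) d1 => [|v].
    by apply: continuous_subspaceT => v; apply: (@cvg_block_mx _ _ (nbhs v));
      [exact: cvg_cst..|exact: cvg_id].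
  by rewrite /GLplus /= det_ublock !det1 mul1r.
Qed.

Lemma GLplus1_path (a : 'M[R]_1) : 0 < a 0 0 -> path_joined R (GLplus (n := 1)) a 1%:M.
Proof.
move=> a0; apply: path_joined_segment => t /andP[t0 t1].
rewrite /GLplus /= det_mx11 !mxE eqxx/= mulr1n.
have -> : a 0 0 + t * (1 - a 0 0) = (1 - t) * a 0 0 + t by ring.
move: t0; rewrite le_eqVlt => /predU1P[<-|t0]; first by rewrite subr0 mul1r addr0.
by apply: ltr_wpDl => //; apply: mulr_ge0; rewrite ?subr_ge0 // ltW.
Qed.

(** Induction on the size by block elimination. A positive (1, 1) entry allows an LDU factorization;
    a nonzero entry below it allows a shear that makes the pivot 1; if the column below vanishes, a
    shear first fills it with copies of the pivot. *)
Lemma GLplus_path n (S : 'M[R]_n) : 0 < \det S -> path_joined R (GLplus (n := n)) S 1%:M.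
Proof.
elim: n S => [S _|n IH]; last rewrite -[n.+1]add1n => S.
  rewrite [1%:M]flatmx0 [S]flatmx0; apply: path_joined_refl.
  by rewrite /GLplus /= det_mx00.
have pivot_pos (X : 'M[R]_(1 + n)) : 0 < \det X -> 0 < ulsubmx X 0 0 ->
    path_joined R (GLplus (n := 1 + n)) X 1%:M.
  rewrite -{1 3}[X]submxK.
  move: (ulsubmx X) (ursubmx X) (dlsubmx X) (drsubmx X) => a r c d X0 a0.
  have ua : a \in unitmx by rewrite unitmxE det_mx11 unitfE gt_eqF.
  (* The middle factor contains the Schur complement of [a], whose determinant is positive because
     those of [X] and [a] are; the induction hypothesis applies to it. *)
  have XE : block_mx a r c d = block_mx 1%:M 0 (c *m invmx a) 1%:M *m
      block_mx a 0 0 (d - c *m invmx a *m r) *m block_mx 1%:M (invmx a *m r) 0 1%:M.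
    rewrite !mulmx_block !(mulmx0, mul0mx, mulmx1, mul1mx, addr0, add0r).
    by rewrite mulKVmx// mulmxKV// mulmxA addrC subrK.
  move: X0; rewrite XE !det_mulmx det_lblock !det_ublock !det1 !mul1r !mulr1.
  rewrite {1}det_mx11 pmulr_rgt0// => d0.
  apply: GLplus_mul1; last exact: GLplus_ushear.
  apply: GLplus_mul1; first exact: GLplus_lshear.
  by apply: GLplus_diag; [exact: GLplus1_path|exact: IH].
have column_neq0 (X : 'M[R]_(1 + n)) : 0 < \det X -> dlsubmx X != 0 ->
    path_joined R (GLplus (n := 1 + n)) X 1%:M.
  move=> X0 c0; set a := ulsubmx X; set c := dlsubmx X in c0 *.
  have cc : 0 < (c^T *m c) 0 0.
    rewrite mxE; under eq_bigr do rewrite mxE.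
    rewrite lt_neqAle sumr_ge0 ?andbT => [|i _]; last by rewrite -expr2 sqr_ge0.
    apply: contra c0 => /eqP/esym/eqP; rewrite psumr_eq0 => [|i _]; last first.
      by rewrite -expr2 sqr_ge0.
    move=> /allP ci; apply/eqP/matrixP => i j; rewrite ord1 [RHS]mxE.
    by have := ci i (mem_index_enum _); rewrite /= mulf_eq0 orbb => /eqP.
  (* Scaled so that [u *m c] is [1 - a]: the shear by [u] turns the pivot into 1. *)
  pose u := ((1 - a 0 0) / (c^T *m c) 0 0) *: c^T.
  have -> : X = block_mx 1%:M (- u) 0 1%:M *m (block_mx 1%:M u 0 1%:M *m X).
    rewrite mulmxA mulmx_block !(mulmx0, mul0mx, mulmx1, mul1mx, addr0, add0r).
    by rewrite subrr -scalar_mx_block mul1mx.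
  apply: GLplus_mul1; first exact: GLplus_ushear.
  apply: pivot_pos; first by rewrite det_mulmx det_ublock !det1 !mul1r.
  rewrite -[X]submxK mulmx_block block_mxKul -/a -/c mul1mx mxE -scalemxAl [X in _ + X]mxE.
  by rewrite divfK ?gt_eqF// addrC subrK.
move=> S0; have [c0|] := eqVneq (dlsubmx S) 0; last exact: column_neq0.
have [|a0] := ltP 0 (ulsubmx S 0 0); first exact: pivot_pos.
have a_neq0 : ulsubmx S 0 0 != 0.
  apply/eqP => aE; move: S0; rewrite -[S]submxK c0 det_ublock.
  by rewrite det_mx11 aE mul0r ltxx.
(* In size 1 the nonpositive pivot would be the determinant itself. In larger size there is a row
   below the pivot to shear into. *)
case: n => [|n] in S IH pivot_pos column_neq0 S0 c0 a0 a_neq0 *.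
  move: S0; rewrite -[S]submxK c0 det_ublock det_mx11 det_mx00 mulr1.
  by rewrite ltNge a0.
pose w : 'cV[R]_n.+1 := const_mx 1.
have -> : S = block_mx 1%:M 0 (- w) 1%:M *m
    (block_mx 1%:M 0 w 1%:M *m S).
  rewrite mulmxA mulmx_block !(mulmx0, mul0mx, mulmx1, mul1mx, addr0, add0r).
  by rewrite addNr -scalar_mx_block mul1mx.
apply: GLplus_mul1; first exact: GLplus_lshear.
apply: column_neq0; first by rewrite det_mulmx det_lblock !det1 !mul1r.
rewrite -[S]submxK mulmx_block block_mxKdl c0 mulmx0 addr0.
apply: contra a_neq0 => /eqP/matrixP/(_ 0 0); rewrite [LHS]mxE big_ord1.
by rewrite [w _ _]mxE mul1r [RHS]mxE => <-; rewrite ord1.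
Qed.

End GLplus.

(** * Positive definite quadratic forms and their stability under perturbation *)

Section QuadraticForms.
Context {R : realType}.

(** Row vectors fit the left kernels [kermx] and the left eigenvectors of [eigenvalue]. *)
Definition qform n (S : 'M[R]_n) (x : 'rV[R]_n) : R := (x *m S *m x^T) 0 0.

(** Symmetry is not part of it: [qpos (- (M *m P))] with [P] symmetric is the Lyapunov inequality M
    P + P M^T < 0. *)
Definition qpos n (S : 'M[R]_n) : Prop := forall x, x != 0 -> 0 < qform S x.

Lemma qformD n (S S' : 'M[R]_n) x : qform (S + S') x = qform S x + qform S' x.
Proof. by rewrite /qform mulmxDr mulmxDl mxE. Qed.

Lemma qformZ n c (S : 'M[R]_n) x : qform (c *: S) x = c * qform S x.
Proof. by rewrite /qform -scalemxAr -scalemxAl mxE. Qed.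

Lemma qformN n (S : 'M[R]_n) x : qform (- S) x = - qform S x.
Proof. by rewrite -scaleN1r qformZ mulN1r. Qed.

Lemma qform_scale n (S : 'M[R]_n) c x : qform S (c *: x) = c ^+ 2 * qform S x.
Proof. by rewrite /qform linearZ /= -!scalemxAl -scalemxAr !mxE mulrA expr2. Qed.

Lemma qform_congr m n (S : 'M[R]_n) (G : 'M[R]_(m, n)) x :
  qform (G *m S *m G^T) x = qform S (x *m G).
Proof. by rewrite /qform trmx_mul !mulmxA. Qed.

Lemma qpos_ge0 n (S : 'M[R]_n) x : qpos S -> 0 <= qform S x.
Proof.
move=> S0; have [->|/S0/ltW//] := eqVneq x 0.
by rewrite /qform !mul0mx mxE.
Qed.

Lemma qpos_congr m n (S : 'M[R]_n) (G : 'M[R]_(m, n)) :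
  row_free G -> qpos S -> qpos (G *m S *m G^T).
Proof.
move=> G0 S0 x x0; rewrite qform_congr; apply: S0.
by rewrite mulmx_free_eq0.
Qed.

Lemma qpos_unitmx n (S : 'M[R]_n) : qpos S -> S \in unitmx.
Proof.
move=> S0; rewrite -row_free_unit -kermx_eq0; apply/rowV0P => x.
move=> /sub_kermxP xS; apply/eqP; apply: contraT => /S0.
by rewrite /qform xS mul0mx mxE ltxx.
Qed.

Lemma qform_continuous n (S : 'M[R]_n) : continuous (qform S).
Proof.
move=> x; apply: (@cvg_coord _ _ (nbhs x)).
apply: (@cvg_mulmx _ _ (nbhs x)).
  by apply: (@cvg_mulmx _ _ (nbhs x)); [exact: cvg_id|exact: cvg_cst].
apply: (@cvg_mx _ _ (nbhs x)) => i j; rewrite mxE; under eq_fun do rewrite mxE.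
exact: coord_continuous.
Qed.

(** Extreme value theorem on the unit sphere of the sup norm, nonempty since [0 < n]. *)
Lemma qform_min n (S : 'M[R]_n) : (0 < n)%N -> exists2 u : 'rV[R]_n, u != 0 &
  forall v, `|v| = 1 -> qform S u <= qform S v.
Proof.
move=> n0; pose A := [set v : 'rV[R]_n | `|v| = 1].
have A0 : A !=set0.
  exists (const_mx 1); rewrite /A /= [LHS]mx_normrE.
  apply/eqP; rewrite eq_le; apply/andP; split.
    by apply: bigmax_le => // i _; rewrite mxE normr1.
  apply: le_trans (le_bigmax _ _ (0, Ordinal n0)).
  by rewrite mxE normr1.
have cA : compact A.
  apply: bounded_closed_compact.
    by exists 1; split=> // x x1 v /= ->; exact: ltW.
  rewrite (_ : A = (fun v : 'rV[R]_n => `|v|) @^-1` [set 1])//.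
  apply: closed_comp; last exact: closed_eq.
  by move=> v _; exact: norm_continuous.
have [u uA umin] := EVT_min_rV A0 cA (continuous_subspaceT (@qform_continuous n S)).
exists u; last by move=> v v1; apply: umin; rewrite inE.
by move: uA; rewrite inE /A /= => u1; rewrite -normr_gt0 u1.
Qed.

(** By homogeneity it suffices to look at the unit sphere, where the form of [S] has a positive
    minimum and that of [D] is bounded below. *)
Lemma qpos_perturb n (S D : 'M[R]_n) : qpos S ->
  exists2 e : R, 0 < e & forall t, 0 <= t <= e -> qpos (S + t *: D).
Proof.
case: n => [|n] in S D *.
  by move=> _; exists 1 => // t _ x; rewrite [x]thinmx0 eqxx.
move=> S0; have [u u0 uS] := qform_min S (ltn0Sn n).
have [w w0 wD] := qform_min D (ltn0Sn n).
have Su0 : 0 < qform S u by exact: S0.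
(* The extra 1 avoids a zero denominator and makes the final inequality strict when [t > 0]. *)
exists (qform S u / (1 + `|qform D w|)) => [|t /andP[t0]].
  by rewrite divr_gt0// ltr_pwDl.
rewrite ler_pdivlMr ?ltr_pwDl// => te x x0.
have nx0 : `|x| != 0 by rewrite normr_eq0.
have -> : x = `|x| *: (`|x|^-1 *: x) by rewrite scalerA divff// scale1r.
have v1 : `| (`|x|^-1 *: x) | = 1 by rewrite normrZ normfV normr_id mulVf.
rewrite qform_scale mulr_gt0// ?exprn_gt0 ?normr_gt0//.
move: (`|x|^-1 *: x) v1 => v v1; rewrite qformD qformZ.
have [t_eq0|t_neq0] := eqVneq t 0.
  by rewrite t_eq0 mul0r addr0 (lt_le_trans Su0)// uS.
have t_gt0 : 0 < t by rewrite lt_neqAle eq_sym t_neq0.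
have tD : - (t * `|qform D w|) <= t * qform D v.
  rewrite -mulrN ler_pM2l// (le_trans _ (wD _ v1))//.
  by rewrite lerNl -normrN ler_norm.
have := uS _ v1; rewrite mulrDr mulr1 in te; lra.
Qed.

End QuadraticForms.

(** * Lyapunov's theorem, in both directions *)

Section Lyapunov.
Context {R : realType}.
Local Notation C := R[i].

Let Re0 : complex.Re (0 : C) = 0. Proof. by []. Qed.
Let Im0 : complex.Im (0 : C) = 0. Proof. by []. Qed.
Let ReD (x y : C) : complex.Re (x + y) = complex.Re x + complex.Re y.
Proof. by case: x y => [? ?] []. Qed.
Let ImD (x y : C) : complex.Im (x + y) = complex.Im x + complex.Im y.
Proof. by case: x y => [? ?] []. Qed.

Lemma Re_mulmx_real m n p (X : 'M[C]_(m, n)) (Y : 'M[R]_(n, p)) :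
  map_mx (@complex.Re R) (X *m map_mx (real_complex R) Y) =
  map_mx (@complex.Re R) X *m Y.
Proof.
apply/matrixP => i j; rewrite !mxE (big_morph _ ReD Re0).
by apply: eq_bigr => k _; rewrite !mxE; case: (X i k) => a b /=; rewrite mulr0 subr0.
Qed.

Lemma Im_mulmx_real m n p (X : 'M[C]_(m, n)) (Y : 'M[R]_(n, p)) :
  map_mx (@complex.Im R) (X *m map_mx (real_complex R) Y) =
  map_mx (@complex.Im R) X *m Y.
Proof.
apply/matrixP => i j; rewrite !mxE (big_morph _ ImD Im0).
by apply: eq_bigr => k _; rewrite !mxE; case: (X i k) => a b /=; rewrite mulr0 add0r.
Qed.

Lemma Re_mulmx_real_l m n p (X : 'M[R]_(m, n)) (Y : 'M[C]_(n, p)) :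
  map_mx (@complex.Re R) (map_mx (real_complex R) X *m Y) =
  X *m map_mx (@complex.Re R) Y.
Proof.
apply/matrixP => i j; rewrite !mxE (big_morph _ ReD Re0).
by apply: eq_bigr => k _; rewrite !mxE; case: (Y k j) => a b /=; rewrite mul0r subr0.
Qed.

Lemma Im_mulmx_real_l m n p (X : 'M[R]_(m, n)) (Y : 'M[C]_(n, p)) :
  map_mx (@complex.Im R) (map_mx (real_complex R) X *m Y) =
  X *m map_mx (@complex.Im R) Y.
Proof.
apply/matrixP => i j; rewrite !mxE (big_morph _ ImD Im0).
by apply: eq_bigr => k _; rewrite !mxE; case: (Y k j) => a b /=; rewrite mul0r addr0.
Qed.

Lemma mx_Re_Im_eq0 m n (X : 'M[C]_(m, n)) :
  map_mx (@complex.Re R) X = 0 -> map_mx (@complex.Im R) X = 0 -> X = 0.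
Proof.
move=> /matrixP X1 /matrixP X2; apply/matrixP => i j.
by have := X1 i j; have := X2 i j; rewrite !mxE; case: (X i j) => a b /= -> ->.
Qed.

(** This is the Lyapunov inequality for P = N G^-T after congruence by [G], the form in which the
    change of variables delivers it. For a left eigenvector with real and imaginary parts a' G and
    b' G, the forms of G M N at a' and b' add up to Re z times those of G N: the terms in Im z
    cancel by symmetry of G N. *)
Lemma stable_of_lyapunov n (M G N : 'M[R]_n) : G \in unitmx ->
  (G *m N)^T = G *m N -> qpos (G *m N) -> qpos (- (G *m M *m N)) -> Defs.stablemx M.
Proof.
move=> uG Tsym Tpos Lneg z /eigenvalueP[v vM v0].
set x := complex.Re z; pose y := complex.Im z.
pose a := map_mx (@complex.Re R) v; pose b := map_mx (@complex.Im R) v.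
have aM : a *m M = x *: a - y *: b.
  rewrite /a -Re_mulmx_real vM; apply/matrixP => i j; rewrite !mxE.
  by rewrite /x /y; case: z {vM x y} (v i j) => [? ?] [].
have bM : b *m M = y *: a + x *: b.
  rewrite /b -Im_mulmx_real vM; apply/matrixP => i j; rewrite !mxE.
  by rewrite /x /y; case: z {vM x y aM} (v i j) => [p q] [r s] /=; rewrite addrC.
have [a' aG] : exists a', a = a' *m G by exists (a *m invmx G); rewrite mulmxKV.
have [b' bG] : exists b', b = b' *m G by exists (b *m invmx G); rewrite mulmxKV.
pose T := G *m N.
have ab : (a' *m T *m b'^T) 0 0 = (b' *m T *m a'^T) 0 0.
  have <- : (a' *m T *m b'^T)^T = b' *m T *m a'^T.
    by rewrite [LHS]trmx_mul [(a' *m T)^T]trmx_mul trmxK Tsym mulmxA.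
  by rewrite [RHS]mxE.
have aL : qform (G *m M *m N) a' = x * qform T a' - y * (b' *m T *m a'^T) 0 0.
  rewrite /qform !mulmxA -aG aM aG bG.
  by rewrite !(mulmxBl, =^~ scalemxAl) -!(mulmxA _ G) -/T !mxE.
have bL : qform (G *m M *m N) b' = y * (a' *m T *m b'^T) 0 0 + x * qform T b'.
  rewrite /qform !mulmxA -bG bM aG bG.
  by rewrite !(mulmxDl, =^~ scalemxAl) -!(mulmxA _ G) -/T !mxE.
have Lsum : qform (G *m M *m N) a' + qform (G *m M *m N) b' =
    x * (qform T a' + qform T b').
  by rewrite aL bL ab; ring.
have [La Lb] := (qpos_ge0 a' Lneg, qpos_ge0 b' Lneg).
have [Ta Tb] := (qpos_ge0 a' Tpos, qpos_ge0 b' Tpos).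
have : qform (G *m M *m N) a' + qform (G *m M *m N) b' < 0.
  move: La Lb; rewrite !qformN => La Lb.
  have [a0|/Lneg] := eqVneq a' 0; last by rewrite qformN; lra.
  have [b0|/Lneg] := eqVneq b' 0; last by rewrite qformN; lra.
  by rewrite (@mx_Re_Im_eq0 _ _ v) ?eqxx// -/a -/b ?aG ?bG ?a0 ?b0 mul0mx in v0.
rewrite Lsum => xT; rewrite ltNge; apply/negP => x0.
by move: xT; rewrite ltNge mulr_ge0// addr_ge0.
Qed.

(** Otherwise the n + 1 distinct numbers [e / k.+1] would all be roots of the characteristic
    polynomial of [- X], which has degree n. *)
Lemma exists_unitmx_shift n (X : 'M[R]_n) (e : R) : 0 < e ->
  exists2 t, 0 <= t <= e & X + t%:M \in unitmx.
Proof.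
move=> e0; apply: contrapT => noroot.
pose rs := [seq e / (k.+1)%:R | k <- iota 0 (size (char_poly (- X)))].
have rsP : all (root (char_poly (- X))) rs.
  apply/allP => _ /mapP[k _ ->]; rewrite -eigenvalue_root_char /eigenvalue.
  rewrite /eigenspace kermx_eq0 row_free_unit -opprD -scaleN1r unitmxZ ?unitrN1//.
  apply/negP => tU; apply: noroot; exists (e / k.+1%:R) => //.
  apply/andP; split; first by rewrite divr_ge0// ltW.
  by rewrite ler_pdivrMr ?ltr0Sn// ler_peMr ?ler1n// ltW.
have urs : uniq rs.
  rewrite map_inj_uniq ?iota_uniq// => k l.
  by move=> /(mulfI (lt0r_neq0 e0))/invr_inj/eqP; rewrite eqr_nat => /eqP[].
have := max_poly_roots (monic_neq0 (char_poly_monic (- X))) rsP urs.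
by rewrite size_map size_iota ltnn.
Qed.

(** The real part of x times the conjugate of y, that is, the Euclidean inner product of the complex
    plane. *)
Definition dotC (x y : C) : R :=
  complex.Re x * complex.Re y + complex.Im x * complex.Im y.

Let dotC0 y : dotC 0 y = 0. Proof. by rewrite /dotC /= !mul0r addr0. Qed.
Let dotCD y (x x' : C) : dotC (x + x') y = dotC x y + dotC x' y.
Proof. by rewrite /dotC ReD ImD; ring. Qed.

Lemma dotC_ge0 x : 0 <= dotC x x.
Proof. by rewrite /dotC -!expr2 addr_ge0// sqr_ge0. Qed.

Lemma dotC_eq0 x : dotC x x = 0 -> x = 0.
Proof.
case: x => a b /eqP; rewrite /dotC /= -!expr2 paddr_eq0 ?sqr_ge0//.
by rewrite !sqrf_eq0 => /andP[/eqP -> /eqP ->].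
Qed.

Lemma dotC_mul_diag x t : dotC (x * t) x = complex.Re t * dotC x x.
Proof. by case: x t => a b [c d]; rewrite /dotC /=; ring. Qed.

(** Expand into four real products and apply the arithmetic-geometric mean inequality to each. *)
Lemma dotC_mul_le x t y :
  dotC (x * t) y <=
    (`|complex.Re t| + `|complex.Im t|) / 2 * (dotC x x + dotC y y).
Proof.
case: x t y => a b [c d] [u v]; rewrite /dotC /=.
have amgm (k x y : R) : k * (x * y) <= `|k| / 2 * (x ^+ 2 + y ^+ 2).
  rewrite (le_trans (ler_norm _))// normrM -mulrA ler_wpM2l// normrM.
  rewrite -(real_normK (num_real x)) -(real_normK (num_real y)).
  by have := sqr_ge0 (`|x| - `|y|); rewrite sqrrB; lra.
have := amgm c a u; have := amgm c b v; have := amgm (- d) b u; have := amgm d a v.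
by rewrite normrN; lra.
Qed.

(* Conjugating by a diagonal matrix puts a factor at most [d] on each
   off-diagonal entry, so that the diagonal dominates when [d] is small. *)
Lemma trig_scaling n (T : 'M[C]_n) : is_trig_mx T ->
  (forall i, complex.Re (T i i) < 0) ->
  exists2 d : R, 0 < d & forall x : 'rV[C]_n, x != 0 ->
    \sum_j dotC ((x *m \matrix_(i, j) ((d ^+ (i - j))%:C%C * T i j)) 0 j) (x 0 j) < 0.
Proof.
move=> /is_trig_mxP Ttrig Tneg.
(* A uniform margin: all diagonal real parts are at most [- c]. *)
pose c := \big[Num.min/1]_i (- complex.Re (T i i)).
have c0 : 0 < c by apply: lt_bigmin => // i _; rewrite oppr_gt0.
have cT i : complex.Re (T i i) <= - c by rewrite lerNr; exact: bigmin_le.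
pose L (z : C) : R := `|complex.Re z| + `|complex.Im z|.
have L0 z : 0 <= L z by rewrite addr_ge0.
pose K := \sum_i \sum_j L (T i j).
have K0 : 0 <= K by apply: sumr_ge0 => i _; apply: sumr_ge0.
have LK i j : L (T i j) <= K.
  rewrite /K (bigD1 i)//= (bigD1 j)//= -addrA lerDl addr_ge0// ?sumr_ge0// => k _.
  exact: sumr_ge0.
(* Chosen so that [d <= 1] and [d * K * n%:R < c], where [K] bounds the size of every entry. *)
pose d := c / (c + K * n%:R + 1).
have Kn0 : 0 <= K * n%:R by exact: mulr_ge0.
have den0 : 0 < c + K * n%:R + 1 by lra.
have d0 : 0 < d by rewrite divr_gt0.
have d1 : d <= 1 by rewrite ler_pdivrMr// mul1r; lra.
have dK : d * K * n%:R < c.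
  have -> : d * K * n%:R = c * (K * n%:R) / (c + K * n%:R + 1) by rewrite /d; ring.
  by rewrite ltr_pdivrMr// ltr_pM2l//; lra.
exists d => // x x0.
pose N j := dotC (x 0 j) (x 0 j).
have N0 j : 0 <= N j by exact: dotC_ge0.
have sumN : 0 < \sum_j N j.
  rewrite lt_neqAle sumr_ge0// andbT eq_sym; apply: contra x0.
  rewrite psumr_eq0// => /allP xj; apply/eqP/rowP => j; rewrite mxE.
  by apply: dotC_eq0; apply/eqP; exact: (xj j (mem_index_enum _)).
(* The truncated exponent is 0 on the diagonal and at least 1 below it, where it yields a factor at
   most [d]; above the diagonal [T] vanishes. *)
have entry (i j : 'I_n) : dotC (x 0 i * ((d ^+ (i - j))%:C%C * T i j)) (x 0 j) <=
    (if i == j then - c * N j else 0) + d * K / 2 * (N i + N j).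
  have dKN : 0 <= d * K / 2 * (N i + N j).
    apply: mulr_ge0; last exact: addr_ge0.
    by apply: divr_ge0 => //; apply: mulr_ge0 => //; exact: ltW.
  move: dKN; case: eqVneq => [->|ij] dKN.
    rewrite subnn expr0 mul1r dotC_mul_diag; apply: ler_wpDr => //.
    by rewrite ler_wpM2r ?N0.
  rewrite add0r; case: (ltngtP i j) => [ij'|ji|/val_inj/eqP]; last by rewrite (negPf ij).
    by rewrite Ttrig// !mulr0 dotC0.
  apply: le_trans (dotC_mul_le _ _ _) _.
  apply: ler_wpM2r; first by apply: addr_ge0; exact: dotC_ge0.
  apply: ler_wpM2r => //.
  have -> : `|complex.Re ((d ^+ (i - j))%:C%C * T i j)| +
      `|complex.Im ((d ^+ (i - j))%:C%C * T i j)| = d ^+ (i - j) * L (T i j).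
    rewrite /L; case: (T i j) => a b /=; rewrite !mul0r subr0 addr0 !normrM.
    by rewrite ger0_norm ?exprn_ge0 1?ltW// mulrDr.
  apply: ler_pM => //; first by rewrite exprn_ge0// ltW.
  by rewrite -[leRHS]expr1 ler_wiXn2l// ?ltW// subn_gt0.
(* Summed over [i] and [j], each of the two halves of [N i + N j] contributes [n] times the total of
   [N]. *)
apply: (@le_lt_trans _ _ ((- c + d * K * n%:R) * \sum_j N j)); last first.
  by rewrite nmulr_rlt0// addrC subr_lt0.
apply: (@le_trans _ _ (\sum_j \sum_i
    ((if i == j then - c * N j else 0) + d * K / 2 * (N i + N j)))).
  apply: ler_sum => j _; rewrite mxE (big_morph _ (dotCD _) (dotC0 _)).
  by apply: ler_sum => i _; rewrite mxE.
have sum_entry j : \sum_i ((if i == j then - c * N j else 0) +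
    d * K / 2 * (N i + N j)) = - c * N j + d * K / 2 * (\sum_i N i + N j * n%:R).
  rewrite big_split /= -big_mkcond big_pred1_eq -mulr_sumr big_split /=.
  by rewrite sumr_const card_ord mulr_natr.
rewrite (eq_bigr _ (fun j _ => sum_entry j)).
rewrite big_split /= -!mulr_sumr [X in _ + _ * X]big_split /= sumr_const card_ord -mulr_suml.
by rewrite -[X in _ + _ * (X + _)]mulr_natr le_eqVlt; apply/orP; left; apply/eqP; field.
Qed.

(** Schur triangularization over the complex numbers followed by diagonal scaling gives [V] with M V
    = V T', where T' is negative for the real inner product. The real part [P] of V times its
    conjugate transpose pulls that inner product back to real rows along w -> w V. *)
Lemma lyapunov_of_stable n (M : 'M[R]_n) : Defs.stablemx M ->
  exists P : 'M[R]_n, [/\ P^T = P, qpos P & qpos (- (M *m P))].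
Proof.
case: (posnP n) => [n0|n_gt0] in M *.
  move=> _; exists 0; split; first exact: trmx0.
    by subst n => x; rewrite [x]thinmx0 eqxx.
  by subst n => x; rewrite [x]thinmx0 eqxx.
move=> Mstable; set Mc := map_mx (real_complex R) M.
have [U Uunitary] := Schur Mc n_gt0.
have uU := unitarymx_unit Uunitary.
rewrite /similar_to /= conjumx//; set T := U *m Mc *m invmx U => Ttrig.
have Tneg i : complex.Re (T i i) < 0.
  apply: Mstable.
  have : eigenvalue T (T i i).
    rewrite eigenvalue_root_char (char_poly_trig Ttrig) rootE horner_prod.
    by rewrite (bigD1 i)//= hornerXsubC subrr mul0r.
  move=> /eigenvalueP[v vT v0]; apply/eigenvalueP; exists (v *m U).
    by rewrite scalemxAl -vT /T !mulmxA mulmxKV.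
  by rewrite mulmx_free_eq0// row_free_unit.
have MU : Mc *m invmx U = invmx U *m T by rewrite /T !mulmxA mulVmx// mul1mx.
clearbody T; have [d d0 dneg] := trig_scaling Ttrig Tneg.
(* With exponents [n - i], T D = D T' on and below the diagonal, since (n - i) + (i - j) = n - j
   when j <= i < n. *)
pose D := diag_mx (\row_(i < n) ((d ^+ (n - i))%:C%C : C)).
pose V := invmx U *m D.
pose T' := \matrix_(i, j) ((d ^+ (i - j))%:C%C * T i j).
have uD : D \in unitmx.
  rewrite unitmxE det_diag unitfE prodf_seq_neq0; apply/allP => i _ /=.
  rewrite mxE; apply/eqP => /(congr1 (@complex.Re R)) /= /eqP.
  by rewrite expf_eq0 gt_eqF// andbF.
have uV : V \in unitmx by rewrite unitmx_mul unitmx_inv uU.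
have MV : Mc *m V = V *m T'.
  rewrite /V -mulmxA; have <- : T *m D = D *m T'.
    rewrite mul_mx_diag mul_diag_mx; apply/matrixP => i j; rewrite !mxE.
    case: (ltnP i j) => [ij|ji]; first by rewrite (is_trig_mxP Ttrig)// mul0r !mulr0.
    rewrite mulrA mulrC -rmorphM /= -exprD; congr (_ %:C%C * _); congr (_ ^+ _).
    by have := ltn_ord i; have := ltn_ord j; lia.
  by rewrite !mulmxA MU.
clearbody V; pose V1 := map_mx (@complex.Re R) V; pose V2 := map_mx (@complex.Im R) V.
pose P := V1 *m V1^T + V2 *m V2^T.
have PE (w w' : 'rV[R]_n) : (w *m P *m w'^T) 0 0 =
    \sum_j dotC ((map_mx (real_complex R) w *m V) 0 j)
                ((map_mx (real_complex R) w' *m V) 0 j).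
  rewrite /P mulmxDr mulmxDl mxE !mulmxA -(mulmxA (w *m V1)) -(mulmxA (w *m V2)).
  rewrite -!trmx_mul -!Re_mulmx_real_l -!Im_mulmx_real_l.
  by rewrite !mxE -big_split /=; apply: eq_bigr => j _; rewrite !mxE.
have wV0 (w : 'rV[R]_n) : w != 0 -> map_mx (real_complex R) w *m V != 0.
  by rewrite mulmx_free_eq0 ?row_free_unit// map_mx_eq0.
exists P; split.
- by rewrite /P raddfD /= !trmx_mul !trmxK.
- move=> w /wV0; rewrite /qform PE; move: (_ *m V) => x x0.
  rewrite lt_neqAle sumr_ge0 ?andbT => [|i _]; last exact: dotC_ge0.
  rewrite eq_sym; apply: contra x0; rewrite psumr_eq0 => [|j _]; last exact: dotC_ge0.
  move=> /allP xj; apply/eqP/rowP => j; rewrite [RHS]mxE.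
  by apply: dotC_eq0; apply/eqP; exact: (xj j (mem_index_enum _)).
- move=> w w0; rewrite qformN oppr_gt0 /qform !mulmxA PE map_mxM -mulmxA MV mulmxA.
  exact: dneg (wV0 _ w0).
Qed.

(* The (2, 1) block is made invertible by adding to the solution a small
   multiple of [[0, 1], [1, 0]]. *)
Lemma lyapunov_of_stable_dl n (M : 'M[R]_(n + n)) : Defs.stablemx M ->
  exists P : 'M[R]_(n + n),
    [/\ P^T = P, qpos P, qpos (- (M *m P)) & dlsubmx P \in unitmx].
Proof.
move=> /lyapunov_of_stable[P [Psym Ppos MP]].
pose D : 'M[R]_(n + n) := block_mx 0 1%:M 1%:M 0.
have [e1 e10 He1] := qpos_perturb D Ppos.
have [e2 e20 He2] := qpos_perturb (- (M *m D)) MP.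
have [|t /andP[t0]] := @exists_unitmx_shift _ (dlsubmx P) (Num.min e1 e2).
  by rewrite lt_min e10.
rewrite le_min => /andP[t1 t2] ut; exists (P + t *: D); split.
- rewrite raddfD /= Psym linearZ /= tr_block_mx !trmx0 trmx1.
  by [].
- by apply: He1; rewrite t0.
- rewrite mulmxDr -scalemxAr opprD -scalerN.
  by apply: He2; rewrite t0.
- by rewrite -[P in P + _]submxK scale_block_mx add_block_mx block_mxKdl scalemx1.
Qed.

End Lyapunov.

(** * Similarity transformations acting on stabilizing controllers *)

Section Similarity.
Context {R : realType} {n m p : nat}.
Variables (A : 'M[R]_n) (B : 'M[R]_(n, m)) (C : 'M[R]_(p, n)).
Implicit Types (S T : 'M[R]_n) (K : 'M[R]_(m + n, p + n)).

Definition closed_loop K : 'M[R]_(n + n) :=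
  block_mx A (B *m ursubmx K) (dlsubmx K *m C) (drsubmx K).

Local Notation Stab := (stabilizing_controllers A B C).
Local Notation sim := (@similarity R n m p).

Lemma invmxM k (S T : 'M[R]_k) : S \in unitmx -> T \in unitmx ->
  invmx (S *m T) = invmx T *m invmx S.
Proof.
move=> uS uT; apply: (can_inj (mulKmx (_ : S *m T \in unitmx))).
  by rewrite unitmx_mul uS.
by rewrite mulmxV ?unitmx_mul ?uS// !mulmxA mulmxK// mulmxV.
Qed.

Lemma similarityM S T K : S \in unitmx -> T \in unitmx ->
  sim (S *m T) K = sim S (sim T K).
Proof.
move=> uS uT; rewrite /similarity invmxM// block_mxKur block_mxKdl block_mxKdr.
by rewrite !mulmxA.
Qed.

Lemma similarity1 K : ulsubmx K = 0 -> sim 1%:M K = K.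
Proof.
by move=> K0; rewrite /similarity invmx1 !mulmx1 !mul1mx -[RHS]submxK K0.
Qed.

Lemma similarityK T K : T \in unitmx -> ulsubmx K = 0 -> sim (invmx T) (sim T K) = K.
Proof.
by move=> uT K0; rewrite -similarityM ?unitmx_inv// mulVmx// similarity1.
Qed.

Lemma similarityVK T K : T \in unitmx -> ulsubmx K = 0 -> sim T (sim (invmx T) K) = K.
Proof.
by move=> uT K0; rewrite -similarityM ?unitmx_inv// mulmxV// similarity1.
Qed.

Lemma stablemx_conj k (G M : 'M[R]_k) : G \in unitmx -> Defs.stablemx M ->
  Defs.stablemx (G *m M *m invmx G).
Proof.
move=> uG Mst z /eigenvalueP[v vM v0]; apply: Mst; apply/eigenvalueP.
have uG' : map_mx (real_complex R) G \in unitmx by rewrite map_unitmx.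
exists (v *m map_mx (real_complex R) G); last first.
  by rewrite mulmx_free_eq0// row_free_unit.
by rewrite scalemxAl -vM !map_mxM map_invmx !mulmxA mulmxKV.
Qed.

Lemma closed_loop_similarity T K : T \in unitmx ->
  closed_loop (sim T K) =
  block_mx 1%:M 0 0 T *m closed_loop K *m block_mx 1%:M 0 0 (invmx T).
Proof.
move=> uT; rewrite /closed_loop /similarity block_mxKur block_mxKdl block_mxKdr.
by rewrite !mulmx_block !(mulmx0, mul0mx, mulmx1, mul1mx, addr0, add0r) !mulmxA.
Qed.

Lemma block_diag_unit T : T \in unitmx ->
  [/\ block_mx (1%:M : 'M[R]_n) 0 0 T \in unitmx &
      invmx (block_mx (1%:M : 'M[R]_n) 0 0 T) = block_mx 1%:M 0 0 (invmx T)].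
Proof.
move=> uT; have DD : block_mx (1%:M : 'M[R]_n) 0 0 T *m block_mx 1%:M 0 0 (invmx T) = 1%:M.
  rewrite mulmx_block !(mulmx0, mul0mx, mulmx1, mul1mx, addr0, add0r) mulmxV//.
  by rewrite -scalar_mx_block.
have [uD _] := mulmx1_unit DD; split=> //.
by rewrite -[LHS]mulmx1 -DD mulmxA mulVmx// mul1mx.
Qed.

Lemma stabP K : Stab K <-> ulsubmx K = 0 /\ Defs.stablemx (closed_loop K).
Proof. by []. Qed.

Lemma similarity_stab T K : T \in unitmx -> Stab K -> Stab (sim T K).
Proof.
move=> uT /stabP[K0 Kst]; apply/stabP; split; first by rewrite block_mxKul.
rewrite (closed_loop_similarity _ uT).
have [uD <-] := block_diag_unit uT; exact: stablemx_conj.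
Qed.

Lemma similarity_is_linear T : linear (sim T).
Proof.
move=> a K K'; apply/matrixP => i j.
have E (P Q : 'M[R]_(m + n, p + n)) : a *: P + Q = block_mx
    (a *: ulsubmx P + ulsubmx Q) (a *: ursubmx P + ursubmx Q)
    (a *: dlsubmx P + dlsubmx Q) (a *: drsubmx P + drsubmx Q).
  by rewrite -add_block_mx -scale_block_mx !submxK.
rewrite {1}/similarity E block_mxKur block_mxKdl block_mxKdr.
rewrite E /similarity !block_mxKur !block_mxKdl !block_mxKdr !block_mxKul.
by rewrite !(mulmxDl, mulmxDr) -!scalemxAl -!scalemxAr -!scalemxAl scaler0 addr0.
Qed.

Lemma cvg_similarity (U : Type) (F : set_system U) (FF : Filter F)
    (f : U -> 'M[R]_n) (g : U -> 'M[R]_(m + n, p + n)) T K : T \in unitmx ->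
  f @ F --> T -> g @ F --> K -> sim (f x) (g x) @[x --> F] --> sim T K.
Proof.
move=> uT fT gK; have fV := cvg_invmx uT fT.
apply: cvg_block_mx; first exact: cvg_cst.
- by apply: cvg_mulmx; [exact: cvg_ursubmx gK|exact: fV].
- by apply: cvg_mulmx; [exact: fT|exact: cvg_dlsubmx gK].
- apply: cvg_mulmx; last exact: fV.
  by apply: cvg_mulmx; [exact: fT|exact: cvg_drsubmx gK].
Qed.

Lemma similarity_continuous T : T \in unitmx -> continuous (sim T).
Proof.
move=> uT K; apply: (@cvg_similarity _ (nbhs K)) => //; exact: cvg_cst.
Qed.

Lemma path_joined_similarity T K K' : T \in unitmx ->
  path_joined R Stab K K' -> path_joined R Stab (sim T K) (sim T K').
Proof.
move=> uT; apply: path_joined_map => [|z]; last exact: similarity_stab.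
by apply: continuous_subspaceT; exact: similarity_continuous.
Qed.

(** Follow the transforms of [K] while the transformation runs from [T] to the identity in
    [GLplus]. *)
Lemma path_joined_det_gt0 T K : 0 < \det T -> Stab K ->
  path_joined R Stab (sim T K) K.
Proof.
move=> T0 Kst.
have T1 := GLplus_path T0.
suff : path_joined R Stab (sim T K) (sim 1%:M K) by rewrite similarity1//; case: Kst.
apply: (@path_joined_map _ _ _ (@GLplus R n) _ (fun X => sim X K)) T1.
  apply/subspace_continuousP => X X0.
  apply: cvg_similarity; [by rewrite unitmxE unitfE gt_eqF| |exact: cvg_cst].
  exact: cvg_within.
by move=> X X0; apply: similarity_stab => //; rewrite unitmxE unitfE gt_eqF.
Qed.

End Similarity.

(** * Scherer's change of variables and the convex matrix inequality *)

Section LMI.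
Context {R : realType} {n m p : nat}.
Variables (A : 'M[R]_n) (B : 'M[R]_(n, m)) (C : 'M[R]_(p, n)).
Implicit Types (S X Y M : 'M[R]_n) (K : 'M[R]_(m + n, p + n)).
Implicit Types (F : 'M[R]_(m, n)) (H : 'M[R]_(n, p)).

Local Notation Stab := (stabilizing_controllers A B C).
Local Notation sim := (@similarity R n m p).

(** For the closed loop A_cl and Lyapunov matrix P, these are the congruences of P and of - A_cl P
    by G = [[Y, Z], [1, 0]], where Z = 1 - Y X and P G^T = [[1, X], [0, 1]]. All blocks are affine
    in the five variables jointly. *)
Definition lmi X Y F H M : Prop :=
  [/\ X^T = X, Y^T = Y, qpos (block_mx Y 1%:M 1%:M X) &
      qpos (- block_mx (Y *m A + H *m C) M A (A *m X + B *m F))].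

(* Inverse of the change of variables [H = (1 - Y X) B_K], [F = C_K],
   [M = (Y A + H C) X + Y B F + (1 - Y X) A_K]. *)
Definition lmi_controller X Y F H M : 'M[R]_(m + n, p + n) :=
  let Z := invmx (1%:M - Y *m X) in
  block_mx 0 F (Z *m H) (Z *m (M - (Y *m A + H *m C) *m X - Y *m B *m F)).

(** If v (1 - Y X) = 0, the row (v, - v Y) is annihilated by the positive definite block matrix. *)
Lemma lmi_unitmx X Y : qpos (block_mx Y 1%:M 1%:M X) -> 1%:M - Y *m X \in unitmx.
Proof.
move=> T0; rewrite -row_free_unit -kermx_eq0; apply/rowV0P => v /sub_kermxP.
rewrite mulmxBr mulmx1 => vYX; apply/eqP; apply: contraT => v0.
have w0 : row_mx v (- (v *m Y)) != 0.
  by apply: contra v0 => /eqP/(congr1 lsubmx); rewrite row_mxKl linear0 => ->.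
have := T0 _ w0; rewrite /qform mul_row_block !mulmx1 subrr mulNmx -mulmxA vYX.
by rewrite row_mx0 mul0mx mxE ltxx.
Qed.

Lemma closed_loop_congr K X Y Z :
  block_mx Y Z 1%:M 0 *m closed_loop A B C K *m block_mx 1%:M X 0 1%:M =
  block_mx (Y *m A + Z *m dlsubmx K *m C)
    ((Y *m A + Z *m dlsubmx K *m C) *m X +
       (Y *m B *m ursubmx K + Z *m drsubmx K))
    A (A *m X + B *m ursubmx K).
Proof.
rewrite /closed_loop !mulmx_block.
by rewrite !(mulmx0, mul0mx, mulmx1, mul1mx, addr0, add0r) !mulmxA.
Qed.

(** [stable_of_lyapunov] applies with G = [[Y, Z], [1, 0]] and N = [[1, X], [0, 1]]: their product
    is the first block matrix of [lmi], and the choice of A_K makes the (1, 2) block of the other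
    one equal to [M]. *)
Lemma lmi_controller_stab X Y F H M :
  lmi X Y F H M -> Stab (lmi_controller X Y F H M).
Proof.
move=> [Xsym Ysym T0 L0]; have uZ := lmi_unitmx T0.
apply/stabP; split; first by rewrite block_mxKul.
set Z := 1%:M - Y *m X in uZ.
have GN : block_mx Y Z 1%:M 0 *m block_mx 1%:M X 0 1%:M = block_mx Y 1%:M 1%:M X.
  rewrite mulmx_block !(mulmx0, mul0mx, mulmx1, mul1mx, addr0, add0r).
  by rewrite /Z addrC subrK.
apply: (@stable_of_lyapunov _ _ _ (block_mx Y Z 1%:M 0) (block_mx 1%:M X 0 1%:M)).
- by have := qpos_unitmx T0; rewrite -GN unitmx_mul => /andP[].
- by rewrite GN tr_block_mx !trmx1 Xsym Ysym.
- by rewrite GN.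
- rewrite closed_loop_congr block_mxKur block_mxKdl block_mxKdr -/Z.
  rewrite !mulmxA mulmxV// mul1mx [X in block_mx _ X _ _](_ : _ = M)//.
  by rewrite ?mul1mx [X in _ + X]addrC subrK addrC subrK.
Qed.

(** Take (Y, Z) to be the first block row of the inverse of [P]. Then Y X + Z = 1, so Z is 1 - Y X
    precisely because the (2, 1) block of [P] is the identity, and congruence by [[Y, Z], [1, 0]]
    gives the two inequalities. *)
Lemma lmi_of_normalized K X Xh : ulsubmx K = 0 ->
  let P := block_mx X 1%:M 1%:M Xh in
  P^T = P -> qpos P -> qpos (- (closed_loop A B C K *m P)) ->
  exists Y F H M, lmi X Y F H M /\ K = lmi_controller X Y F H M.
Proof.
move=> K0 P Psym P0 MP0; have uP := qpos_unitmx P0.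
have Xsym : X^T = X.
  by have := Psym; rewrite /P tr_block_mx => /eq_block_mx[].
pose Y := ulsubmx (invmx P); pose Z := ursubmx (invmx P).
have Ysym : Y^T = Y by rewrite /Y trmx_ulsub trmx_inv Psym.
have := mulVmx uP; rewrite -{1}[invmx P]submxK {1}/P -/Y -/Z.
rewrite mulmx_block (scalar_mx_block n n) !mulmx1 => /eq_block_mx[YXZ YZX _ _].
have ZE : 1%:M - Y *m X = Z by rewrite -YXZ addrC addKr.
(* If v Z = 0, then Y + Z Xh = 0 gives v Y = 0, and Y X + Z = 1 gives v = 0. *)
have uZ : Z \in unitmx.
  rewrite -row_free_unit -kermx_eq0; apply/rowV0P => v /sub_kermxP vZ.
  have vY : v *m Y = 0.
    have : v *m (Y + Z *m Xh) = 0 by rewrite YZX mulmx0.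
    by rewrite mulmxDr mulmxA vZ mul0mx addr0.
  by rewrite -[v]mulmx1 -YXZ mulmxDr mulmxA vY vZ mul0mx addr0.
pose G := block_mx Y Z 1%:M 0.
have GP : G *m P = (block_mx 1%:M X 0 1%:M)^T.
  rewrite /G /P mulmx_block !(mulmx0, mul0mx, mulmx1, mul1mx, addr0, add0r).
  by rewrite YXZ YZX tr_block_mx !trmx1 trmx0 Xsym.
have PG : P *m G^T = block_mx 1%:M X 0 1%:M.
  by rewrite -[LHS]trmxK trmx_mul trmxK Psym GP trmxK.
have GPG : G *m P *m G^T = block_mx Y 1%:M 1%:M X.
  rewrite -mulmxA PG /G mulmx_block !(mulmx0, mul0mx, mulmx1, mul1mx, addr0, add0r).
  by rewrite YXZ.
have freeG : row_free G.
  have uG : G *m block_mx 0 1%:M (invmx Z) (- (invmx Z *m Y)) = 1%:M.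
    rewrite /G mulmx_block !(mulmx0, mul0mx, mulmx1, mul1mx, addr0, add0r).
    by rewrite mulmxN mulmxV// mulmxA mulmxV// mul1mx subrr -scalar_mx_block.
  by rewrite row_free_unit; have [] := mulmx1_unit uG.
exists Y, (ursubmx K), (Z *m dlsubmx K),
  ((Y *m A + Z *m dlsubmx K *m C) *m X + (Y *m B *m ursubmx K + Z *m drsubmx K)).
split; last first.
  rewrite /lmi_controller ZE mulKmx// -[LHS]submxK K0; congr block_mx.
  by rewrite [X in X - _ - _]addrC addrK [X in X - _]addrC addrK mulKmx.
split => //; first by rewrite -GPG; exact: qpos_congr.
rewrite -closed_loop_congr -/G -PG !mulmxA -(mulmxA G) -mulNmx -mulmxN.
exact: qpos_congr.
Qed.

(** The similarity by the inverse of the (2, 1) block of the Lyapunov matrix replaces that matrix by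
    its congruence by diag(1, S), whose (2, 1) block is the identity. *)
Lemma exists_lmi_controller K : Stab K -> exists S X Y F H M,
  [/\ S \in unitmx, lmi X Y F H M & sim S K = lmi_controller X Y F H M].
Proof.
move=> /stabP[K0 /lyapunov_of_stable_dl[P [Psym P0 MP0 uP]]].
set S := invmx (dlsubmx P); have uS : S \in unitmx by rewrite unitmx_inv.
pose D := block_mx (1%:M : 'M[R]_n) 0 0 S.
have [uD invD] := block_diag_unit uS.
have freeD : row_free D by rewrite row_free_unit.
pose P' := D *m P *m D^T.
have P'sym : P'^T = P' by rewrite /P' trmx_mul trmxK trmx_mul Psym mulmxA.
have dlP' : dlsubmx P' = 1%:M.
  rewrite /P' /D -{1}[P]submxK tr_block_mx !trmx1 !trmx0 !mulmx_block.
  rewrite block_mxKdl !(mulmx0, mul0mx, mulmx1, mul1mx, addr0, add0r).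
  by rewrite mulVmx.
have P'E : P' = block_mx (ulsubmx P') 1%:M 1%:M (drsubmx P').
  by rewrite -[LHS]submxK dlP' -[ursubmx P']trmxK trmx_ursub P'sym dlP' trmx1.
have sK0 : ulsubmx (sim S K) = 0 by rewrite block_mxKul.
have := @lmi_of_normalized (sim S K) (ulsubmx P') (drsubmx P') sK0.
rewrite /= -P'E => /(_ P'sym)[||Y [F [H [M [L E]]]]].
- exact: qpos_congr.
- rewrite closed_loop_similarity// -invD -/D /P' !mulmxA mulmxKV//.
  by rewrite -(mulmxA D) -mulNmx -mulmxN; exact: qpos_congr.
- by exists S, (ulsubmx P'), Y, F, H, M.
Qed.

(** Clamping keeps the point in the segment for every real [t], as the global paths of
    [path_joinedP] require. *)
Let seg k l (U V : 'M[R]_(k, l)) (t : R) := U + clamp01 t *: (V - U).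

Let seg_continuous k l (U V : 'M[R]_(k, l)) : continuous (seg U V).
Proof.
move=> t; apply: cvgD; first exact: cvg_cst.
by apply: cvgZ; [exact: clamp01_continuous|exact: cvg_cst].
Qed.

Let qpos_seg k (U V : 'M[R]_k) t : qpos U -> qpos V -> qpos (seg U V t).
Proof.
move=> U0 V0 x x0; have /andP[t0 t1] := clamp01_itv t.
rewrite /seg; move: (clamp01 t) t0 t1 => s s0 s1.
rewrite qformD qformZ qformD qformN.
have := U0 _ x0; have := V0 _ x0; move: (qform U x) (qform V x) => u v v0 u0.
have -> : u + s * (v - u) = (1 - s) * u + s * v by ring.
move: s0; rewrite le_eqVlt => /predU1P[<-|s0]; first by rewrite subr0 mul1r mul0r addr0.
by apply: ltr_wpDl; [apply: mulr_ge0; rewrite ?subr_ge0 // ltW|exact: mulr_gt0].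
Qed.

Let seg_lin k l q (U V : 'M[R]_(k, l)) (W : 'M[R]_(l, q)) t :
  seg U V t *m W = seg (U *m W) (V *m W) t.
Proof. by rewrite /seg mulmxDl -scalemxAl mulmxBl. Qed.

Let seg_linr k l q (U V : 'M[R]_(k, l)) (W : 'M[R]_(q, k)) t :
  W *m seg U V t = seg (W *m U) (W *m V) t.
Proof. by rewrite /seg mulmxDr -scalemxAr mulmxBr. Qed.

Let seg_cst k l (U : 'M[R]_(k, l)) t : seg U U t = U.
Proof. by rewrite /seg subrr scaler0 addr0. Qed.

Let seg_add k l (U V U' V' : 'M[R]_(k, l)) t :
  seg U V t + seg U' V' t = seg (U + U') (V + V') t.
Proof. by rewrite /seg addrACA -scalerDr opprD addrACA. Qed.

Let seg_opp k l (U V : 'M[R]_(k, l)) t : - seg U V t = seg (- U) (- V) t.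
Proof. by rewrite /seg opprD -scalerN opprB opprK [- V + U]addrC. Qed.

Let seg_block k (U1 U2 U3 U4 V1 V2 V3 V4 : 'M[R]_k) t :
  block_mx (seg U1 V1 t) (seg U2 V2 t) (seg U3 V3 t) (seg U4 V4 t) =
  seg (block_mx U1 U2 U3 U4) (block_mx V1 V2 V3 V4) t.
Proof. by rewrite /seg opp_block_mx add_block_mx scale_block_mx add_block_mx. Qed.

Let seg_tr k (U V : 'M[R]_k) t : (seg U V t)^T = seg U^T V^T t.
Proof. by rewrite /seg raddfD /= linearZ /= raddfB. Qed.

Lemma lmi_seg X Y F H M X' Y' F' H' M' t :
  lmi X Y F H M -> lmi X' Y' F' H' M' ->
  lmi (seg X X' t) (seg Y Y' t) (seg F F' t) (seg H H' t) (seg M M' t).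
Proof.
move=> [X1 Y1 T1 L1] [X2 Y2 T2 L2]; split; rewrite ?seg_tr ?X1 ?X2 ?Y1 ?Y2//.
(* The constant blocks are written as constant segments, so that each block matrix is itself a
   segment between positive definite ones. *)
- by rewrite -(seg_cst 1%:M t) seg_block; exact: qpos_seg.
- rewrite !(seg_lin, seg_linr) !seg_add -[in X in block_mx _ _ X](seg_cst A t).
  by rewrite seg_block seg_opp; exact: qpos_seg.
Qed.

(** The inequality holds along the segment of variables, so 1 - Y X stays invertible there and the
    recovered controller varies continuously. *)
Lemma path_joined_lmi_controller X Y F H M X' Y' F' H' M' :
  lmi X Y F H M -> lmi X' Y' F' H' M' ->
  path_joined R Stab (lmi_controller X Y F H M) (lmi_controller X' Y' F' H' M').
Proof.
move=> L L'; apply/path_joinedP.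
exists (fun t => lmi_controller (seg X X' t) (seg Y Y' t) (seg F F' t)
  (seg H H' t) (seg M M' t)).
have seg0 k l (U V : 'M[R]_(k, l)) : seg U V 0 = U.
  by rewrite /seg clamp01_id ?lexx ?ler01// scale0r addr0.
have seg1 k l (U V : 'M[R]_(k, l)) : seg U V 1 = V.
  by rewrite /seg clamp01_id ?lexx ?ler01// scale1r addrC subrK.
split; rewrite ?seg0 ?seg1//; last by move=> t; apply: lmi_controller_stab; exact: lmi_seg.
move=> t; have [_ _ T0 _] := lmi_seg t L L'.
have Zc : invmx (1%:M - seg Y Y' s *m seg X X' s) @[s --> t] -->
    invmx (1%:M - seg Y Y' t *m seg X X' t).
  apply: (@cvg_invmx _ _ (nbhs t)); first exact: lmi_unitmx.
  apply: cvgB; first exact: cvg_cst.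
  by apply: (@cvg_mulmx _ _ (nbhs t)); exact: seg_continuous.
apply: (@cvg_block_mx _ _ (nbhs t)); [exact: cvg_cst|exact: seg_continuous| |].
  by apply: (@cvg_mulmx _ _ (nbhs t)) => //; exact: seg_continuous.
apply: (@cvg_mulmx _ _ (nbhs t)) => //; apply: cvgB; last first.
  apply: (@cvg_mulmx _ _ (nbhs t)); last exact: seg_continuous.
  by apply: (@cvg_mulmx _ _ (nbhs t)); [exact: seg_continuous|exact: cvg_cst].
apply: cvgB; first exact: seg_continuous.
apply: (@cvg_mulmx _ _ (nbhs t)); last exact: seg_continuous.
by apply: cvgD; apply: (@cvg_mulmx _ _ (nbhs t));
  by [exact: seg_continuous|exact: cvg_cst].
Qed.

(** Move both controllers into LMI form by [S] and [S'], join them there, and carry the path back by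
    the inverse of [S']. *)
Lemma path_joined_up_to_similarity K K' : Stab K -> Stab K' ->
  exists2 S, S \in unitmx & path_joined R Stab (sim S K) K'.
Proof.
move=> Kst K'st.
have [S [X [Y [F [H [M [uS L SK]]]]]]] := exists_lmi_controller Kst.
have [S' [X' [Y' [F' [H' [M' [uS' L' SK']]]]]]] := exists_lmi_controller K'st.
exists (invmx S' *m S); first by rewrite unitmx_mul unitmx_inv uS'.
rewrite similarityM ?unitmx_inv//; case: (K'st) => K'0 _.
rewrite -[X in path_joined _ _ _ X](similarityK uS' K'0).
apply: path_joined_similarity; first by rewrite unitmx_inv.
by rewrite SK SK'; exact: path_joined_lmi_controller.
Qed.

End LMI.

(** * Smoothness of continuous linear maps *)

Section SmoothLinear.
Context {R : realType} {E F : normedModType R}.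

Lemma Ck_on_cst k (L U : set E) (c : F) : Ck_on k L U (cst c).
Proof.
elim: k c => [|k IH] c; split=> //; try by apply: continuous_subspaceT => x; exact: cvg_cst.
move=> v _; split => [x _|]; first exact: derivable_cst.
rewrite (_ : (fun x => _) = cst 0) ?IH//; first by apply/funext => x; exact: derive_cst.
Qed.

(** The derivative in direction [v] is the constant [f v], so induction is needed only for
    constants. *)
Lemma smooth_on_linear (L U : set E) (f : {linear E -> F}) :
  continuous f -> smooth_on L U f.
Proof.
move=> fc; case=> [|k]; split=> //; try exact: continuous_subspaceT.
have df x : differentiable f x by exact: linear_differentiable.
move=> v _; split => [x _|]; first exact: diff_derivable.
rewrite (_ : (fun x => _) = cst (f v)); first exact: Ck_on_cst.
by apply/funext => x; rewrite deriveE// diff_lin.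
Qed.

End SmoothLinear.

Lemma smooth_on_similarity (R : realType) (n m p : nat) (T : 'M[R]_n)
    (L U : set 'M[R]_(m + n, p + n)) :
  T \in unitmx -> smooth_on L U (@similarity R n m p T).
Proof.
move=> uT; pose simM := GRing.isLinear.Build _ _ _ _ _ (similarity_is_linear (m:=m) (p:=p) T).
pose simL : {linear _ -> _} := HB.pack (@similarity R n m p T) simM.
by apply: (@smooth_on_linear _ _ _ L U simL); exact: similarity_continuous.
Qed.

(** * Sets with exactly two path components *)

Section Components.
Context {R : realType} {E : normedModType R} (S C1 C2 : set E).
Hypothesis comp : path_components R S = [set D | D = C1 \/ D = C2].
Hypothesis C12 : C1 <> C2.

Lemma path_component_inl : exists2 x, S x & C1 = [set y | path_joined R S x y].
Proof. by have : path_components R S C1 by rewrite comp; left. Qed.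

Lemma path_component_inr : exists2 x, S x & C2 = [set y | path_joined R S x y].
Proof. by have : path_components R S C2 by rewrite comp; right. Qed.

Lemma path_components_cover x : S x -> C1 x \/ C2 x.
Proof.
move=> Sx; have : path_components R S [set y | path_joined R S x y] by exists x.
by rewrite comp => -[<-|<-]; [left|right]; exact: path_joined_refl.
Qed.

(** A common point would make the two equivalence classes equal. *)
Lemma path_components_disjoint x : C1 x -> C2 x -> False.
Proof.
have [x1 _ E1] := path_component_inl; have [x2 _ E2] := path_component_inr.
rewrite E1 E2 => x1x x2x; apply: C12; rewrite E1 E2; apply/seteqP; split=> y /= h.
- apply: path_joined_trans x2x _; apply: path_joined_trans (path_joined_sym x1x) h.
- apply: path_joined_trans x1x _; apply: path_joined_trans (path_joined_sym x2x) h.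
Qed.

Lemma path_components_closed x y : path_joined R S x y ->
  (C1 x -> C1 y) /\ (C2 x -> C2 y).
Proof.
move=> xy; have [x1 _ ->] := path_component_inl; have [x2 _ ->] := path_component_inr.
by split=> /path_joined_trans; exact.
Qed.

Lemma path_components_sub : C1 `<=` S /\ C2 `<=` S.
Proof.
have [x1 _ ->] := path_component_inl; have [x2 _ ->] := path_component_inr.
by split=> y xy; case: (path_joined_mem xy).
Qed.

End Components.

(** * Exchange of the two components by negative determinants *)

Section SwapComponents.
Context {R : realType} {n m p : nat}.
Variables (A : 'M[R]_n) (B : 'M[R]_(n, m)) (C : 'M[R]_(p, n)).
Local Notation Stab := (stabilizing_controllers A B C).
Local Notation sim := (@similarity R n m p).

(* If K1 and sim T K1 were both in C1, then every sim S K1 would be path-joined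
   to one of them, hence to K1, whereas every element of C2 is path-joined to
   some sim S K1. *)
Lemma similarity_swap (C1 C2 : set 'M[R]_(m + n, p + n)) (T : 'M[R]_n) :
  path_components R Stab = [set D | D = C1 \/ D = C2] -> C1 <> C2 ->
  \det T < 0 -> forall K, C1 K -> C2 (sim T K).
Proof.
move=> comp C12 T0 K K1.
have uT : T \in unitmx by rewrite unitmxE unitfE lt_eqF.
have [C1S C2S] := path_components_sub comp.
have Kst := C1S _ K1; have TKst := similarity_stab uT Kst.
have [TK1|//] := path_components_cover comp TKst.
have [K2 K2st C2E] := path_component_inr comp.
have K2C2 : C2 K2 by rewrite C2E; exact: path_joined_refl.
have [S uS SK] := path_joined_up_to_similarity Kst K2st.
exfalso; apply: (path_components_disjoint comp C12 _ K2C2).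
apply: (path_components_closed comp SK).1.
have [S0|S0] := ltP 0 (\det S).
  exact: (path_components_closed comp (path_joined_sym (path_joined_det_gt0 S0 Kst))).1.
have {}S0 : \det S < 0 by rewrite lt_neqAle S0 andbT -unitfE -unitmxE.
(* Factor [S] as (S T^-1) T: the first factor has positive determinant, so the transform by [S] lies
   in the component of the transform by [T]. *)
rewrite -(mulmxKV uT S) similarityM ?unitmx_mul ?unitmx_inv ?uS//.
apply: (path_components_closed comp (path_joined_sym (path_joined_det_gt0 _ TKst))).1 => //.
by rewrite det_mulmx det_inv nmulr_rgt0// invr_lt0.
Qed.

End SwapComponents.

Theorem theorem3p2 (R : realType) (n m p : nat)
  (hn : (1 <= n)%N) (hm : (1 <= m)%N) (hp : (1 <= p)%N)
  (A : 'M[R]_n) (B : 'M[R]_(n, m)) (C : 'M[R]_(p, n))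
  (W : 'M[R]_n) (V : 'M[R]_p) (Q : 'M[R]_n) (Ru : 'M[R]_m)
  (hW : psdmx W) (hV : pdmx V) (hQ : psdmx Q) (hRu : pdmx Ru)
  (hAB : controllable A B) (hAW : controllable A (sqrtmx W))
  (hCA : observable C A) (hQA : observable (sqrtmx Q) A)
  (C1 C2 : set 'M[R]_(m + n, p + n))
  (hC12 : C1 <> C2)
  (hcomp : path_components R (stabilizing_controllers A B C) =
           [set D | D = C1 \/ D = C2])
  (T : 'M[R]_n) (hT : T \in unitmx) (hdet : \det T < 0) :
  diffeomorphism_on (@controller_space R n m p) C1 C2
    (@similarity R n m p T).
Proof.
have [C1S C2S] := path_components_sub hcomp.
(* With the roles of [C1] and [C2] exchanged, the swap applies to [invmx T], also of negative
   determinant; this gives surjectivity. *)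
have hcomp' : path_components R (stabilizing_controllers A B C) =
    [set D | D = C2 \/ D = C1].
  by rewrite hcomp; apply/seteqP; split=> D /= -[]; auto.
have C1K K : C1 K -> similarity (invmx T) (similarity T K) = K.
  by move=> /C1S[K0 _]; exact: similarityK.
split.
- split=> [K K1|K K'|K K2].
  + exact: similarity_swap hcomp hC12 hdet _ K1.
  + by rewrite !inE => /C1K {2}<- /C1K {2}<- ->.
  + exists (similarity (invmx T) K).
      apply: similarity_swap hcomp' _ _ _ K2; first exact: nesym.
      by rewrite det_inv invr_lt0.
    by have [K0 _] := C2S _ K2; exact: similarityVK.
- exact: smooth_on_similarity.
- exists (similarity (invmx T)); split => //.
  by apply: smooth_on_similarity; rewrite unitmx_inv.
Qed.
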